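(* Let $n\ge 1$ and $\ell\ge 1$ be integers. The number of occurrences of the pattern $\tau=\underbrace{1\text{-}1\text{-}\cdots\text{-}1}_{\ell}=1^{\ell}$ in the $n$-th Peano word $X_n$ is equal to $$\binom{4^{n-1}-2^{n-1}}{\ell}+2\binom{4^{n-1}}{\ell}+\binom{4^{n-1}+2^{n-1}-1}{\ell}.$$
   Context: All words are finite words over the alphabet $\{1,2,3,4\}$. For a word $A$, $\varphi_1(A)$ is the word obtained by reversing $A$ and then replacing each letter according to $1\mapsto 4$, $2\mapsto 1$, $3\mapsto 2$, $4\mapsto 3$; $\varphi_2(A)$ is the word obtained by reversing $A$ and then replacing each letter according to $1\mapsto 2$, $2\mapsto 3$, $3\mapsto 4$, $4\mapsto 1$. The Peano words $X_n$ ($n\ge1$) are defined by $X_1=123$ and, for $n\ge 2$, the concatenation $X_n=\varphi_1(X_{n-1})\,1\,X_{n-1}\,2\,X_{n-1}\,3\,\varphi_2(X_{n-1})$; for example $X_2=214112321233432$. An occurrence of the pattern $1^\ell$ in a word $w_1w_2\cdots w_m$ is a choice of indices $i_1<i_2<\cdots<i_\ell$ (not necessarily adjacent) with $w_{i_1}=w_{i_2}=\cdots=w_{i_\ell}$. *)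

(* Defs.v *)
From HB Require Import structures.
From mathcomp Require Import all_boot.

Set Implicit Arguments.
Unset Strict Implicit.
Unset Printing Implicit Defensive.

Inductive letter : Type := L1 | L2 | L3 | L4.

Definition nat_of_letter (a : letter) : nat :=
  match a with L1 => 1 | L2 => 2 | L3 => 3 | L4 => 4 end.

Definition letter_of_nat (k : nat) : option letter :=
  match k with
  | 1 => Some L1 | 2 => Some L2 | 3 => Some L3 | 4 => Some L4
  | _ => None
  end.

Lemma nat_of_letterK : pcancel nat_of_letter letter_of_nat.
Proof. by case. Qed.

HB.instance Definition _ := Equality.copy letter (pcan_type nat_of_letterK).

Definition word : Type := seq letter.

Definition subst1 (a : letter) : letter :=
  match a with L1 => L4 | L2 => L1 | L3 => L2 | L4 => L3 end.

Definition subst2 (a : letter) : letter :=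
  match a with L1 => L2 | L2 => L3 | L3 => L4 | L4 => L1 end.

Definition phi1 (A : word) : word := [seq subst1 a | a <- rev A].

Definition phi2 (A : word) : word := [seq subst2 a | a <- rev A].

(* The value at 0 is a junk value: Peano words are indexed from 1. *)
Fixpoint peano (n : nat) : word :=
  match n with
  | 0 => [::]
  | 1 => [:: L1; L2; L3]
  | (_.+1 as m).+1 =>
      phi1 (peano m) ++ [:: L1] ++ peano m ++ [:: L2] ++ peano m ++
        [:: L3] ++ phi2 (peano m)
  end.

Example peano2E :
  map nat_of_letter (peano 2) = [:: 2;1;4;1;1;2;3;2;1;2;3;3;4;3;2].
Proof. by []. Qed.

(* Indices are 0-based positions of w; an occurrence of 1^l is the strictly
   increasing tuple i_1 < ... < i_l itself. *)
Definition occurrences (l : nat) (w : word) : {set l.-tuple 'I_(size w)} :=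
  [set t : l.-tuple 'I_(size w) |
     sorted ltn [seq val i | i <- t]
     && constant [seq tnth (in_tuple w) i | i <- t]].

(* Main.v *)
(* An occurrence of 1^l with l >= 1 is a choice of l positions carrying one and
   the same letter, so occurrences are counted by summing C(c_a, l) over the
   letters a, where c_a is the number of letters a. The recursion for X_n
   becomes a linear recursion for (c_1, c_2, c_3, c_4), whose solution is
   (4^m, 4^m + 2^m - 1, 4^m, 4^m - 2^m) with m = n - 1. *)
Require Import Defs.
From mathcomp Require Import all_boot.
From mathcomp Require Import zify.

(** A strictly increasing tuple is determined by its set of entries, so [f] is a bijection onto the
    [l]-subsets of [A]. *)
Lemma card_sorted_tuples_in n l (A : {set 'I_n}) :
  #|[set t : l.-tuple 'I_n | sorted ltn (map val t) && all (mem A) t]| =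
    'C(#|A|, l).
Proof.
pose f (t : l.-tuple 'I_n) := [set i in t].
have uniq_sorted (t : seq 'I_n) : sorted ltn (map val t) -> uniq t.
  by move/(sorted_uniq ltn_trans ltnn); rewrite (map_inj_uniq val_inj).
rewrite -cards_draws -(card_in_imset (f := f)) => [|t u]; last first.
  rewrite !inE => /andP[st _] /andP[su _] /setP eq_tu.
  apply/val_inj/(inj_map val_inj)/(irr_sorted_eq ltn_trans ltnn st su) => k.
  by apply/mapP/mapP => -[i i_in ->]; exists i => //; move: (eq_tu i);
    rewrite !inE i_in.
apply/eq_card => B; rewrite [RHS]inE; apply/imsetP/andP.
  case=> t; rewrite inE => /andP[st /allP tA] ->; split.
    by apply/subsetP => i; rewrite inE => /tA.
  by rewrite cardsE (card_uniqP (uniq_sorted _ st)) size_tuple.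
case=> /subsetP BA /eqP cardB.
have size_B : size (enum B) == l by rewrite -cardE cardB.
exists (Tuple size_B); last by apply/setP => i; rewrite inE mem_enum.
rewrite inE /=; apply/andP; split; last first.
  by apply/allP => i; rewrite mem_enum => /BA.
(* [enum B] is increasing as a filter of [enum 'I_n], whose values form an [iota]. *)
rewrite -[enum _](eq_filter (mem_enum _)).
rewrite -(eq_filter (mem_map val_inj _)) -filter_map (sorted_filter ltn_trans) //.
by rewrite -enumT val_enum_ord iota_ltn_sorted.
Qed.

Lemma card_tnth_eq (T : eqType) (w : seq T) (a : T) :
  #|[set i | tnth (in_tuple w) i == a]| = count_mem a w.
Proof.
rewrite cardsE cardE size_filter -enumT.
have -> : count_mem a w = count_mem a (map (tnth (in_tuple w)) (enum 'I_(size w))).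
  by rewrite map_tnth_enum.
by rewrite count_map.
Qed.

(** Only the first letter can contribute; the empty word would be counted four times. *)
Lemma constant_letterE (s : word) : 0 < size s ->
  constant s = \sum_(a <- [:: L1; L2; L3; L4]) all (pred1 a) s :> nat.
Proof.
case: s => // b s _; rewrite !big_cons big_nil /=.
by case: b; rewrite /= !(add0n, addn0).
Qed.

Lemma card_occurrences l (w : word) : 0 < l ->
  #|occurrences l w| = \sum_(a <- [:: L1; L2; L3; L4]) 'C(count_mem a w, l).
Proof.
move=> l_gt0; rewrite -sum1_card big_mkcond /=.
transitivity (\sum_(t : l.-tuple 'I_(size w)) \sum_(a <- [:: L1; L2; L3; L4])
    (sorted ltn (map val t) && all (pred1 a) (map (tnth (in_tuple w)) t) : nat)).
  apply: eq_bigr => t _; rewrite inE; case: (sorted _ _) => /=; last by rewrite big1.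
  by rewrite -constant_letterE ?size_map ?size_tuple //; case: (constant _).
(* For a fixed letter [a], what remains are the increasing tuples inside the set of positions of
   [a]. *)
rewrite exchange_big; apply: eq_bigr => a _ /=.
rewrite -card_tnth_eq -card_sorted_tuples_in -sum1_card [RHS]big_mkcond /=.
apply: eq_bigr => t _; rewrite inE all_map.
rewrite (@eq_all _ (mem [set i | tnth (in_tuple w) i == a])
  (preim (tnth (in_tuple w)) (pred1 a))) => [|i]; last by rewrite /= inE.
by case: (_ && _).
Qed.

(** Reversal keeps counts, and [subst2] is the inverse of [subst1]. *)
Lemma count_phi1 a (w : word) : count_mem a (phi1 w) = count_mem (subst2 a) w.
Proof.
by rewrite /phi1 count_map count_rev; apply: eq_count; case: a => -[].
Qed.

Lemma count_phi2 a (w : word) : count_mem a (phi2 w) = count_mem (subst1 a) w.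
Proof.
by rewrite /phi2 count_map count_rev; apply: eq_count; case: a => -[].
Qed.

Lemma count_peano m :
  [/\ count_mem L1 (peano m.+1) = 4 ^ m,
      count_mem L2 (peano m.+1) = 4 ^ m + 2 ^ m - 1,
      count_mem L3 (peano m.+1) = 4 ^ m
    & count_mem L4 (peano m.+1) = 4 ^ m - 2 ^ m].
Proof.
elim: m => [//|m [c1 c2 c3 c4]].
have peanoS : peano m.+2 = phi1 (peano m.+1) ++ [:: L1] ++ peano m.+1 ++
  [:: L2] ++ peano m.+1 ++ [:: L3] ++ phi2 (peano m.+1) by [].
(* These two bounds make the truncated subtractions exact. *)
have pow_gt0 : 0 < 2 ^ m by rewrite expn_gt0.
have le_pow : 2 ^ m <= 4 ^ m by case: (m) => // k; rewrite leq_exp2r.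
(* With indices cyclic, the new count of letter [a] is c_(a-1) + 2 c_a + c_(a+1), plus 1 unless [a]
   is [L4]. *)
by split; rewrite peanoS !count_cat count_phi1 count_phi2 /= !expnS
  ?c1 ?c2 ?c3 ?c4; lia.
Qed.

Theorem corollary2 (n l : nat) (hn : 1 <= n) (hl : 1 <= l) :
  #|occurrences l (peano n)| =
    'C(4 ^ (n - 1) - 2 ^ (n - 1), l) + 2 * 'C(4 ^ (n - 1), l)
      + 'C(4 ^ (n - 1) + 2 ^ (n - 1) - 1, l).
Proof.
case: n hn => // m _; rewrite subn1 /= card_occurrences // !big_cons big_nil.
by have [-> -> -> ->] := count_peano m; lia.
Qed.
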